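(* Let $C\subset\mathbb{R}^n$ be a full-dimensional convex cone that is not polyhedral. Suppose that $C$ has only finitely many rational extreme rays $[u_1],\dots,[u_m]$ (with $u_1,\dots,u_m\in\mathbb{Q}^n$), and that $\operatorname{span}_{\mathbb{R}}\{u_1,\dots,u_m\}=\mathbb{R}^n$. Then $C\cap\mathbb{Z}^n$ is not $(R,G)$-finitely generated.
   Context: For $u\in\mathbb{R}^n$, $[u]=\{cu:c>0\}$ denotes the ray generated by $u$; an extreme ray $[u]$ is rational if $[u]=[u']$ for some $u'\in\mathbb{Q}^n$. $\mathrm{GL}(n,\mathbb{Z})$ is the group of integer $n\times n$ matrices with determinant $\pm1$. For a convex cone $C\subseteq\mathbb{R}^n$ let $S_C:=C\cap\mathbb{Z}^n$. $S_C$ (equivalently $C$) is called $(R,G)$-finitely generated if there exist a finite subset $R\subseteq S_C$ and a finitely generated subgroup $G\subseteq\mathrm{GL}(n,\mathbb{Z})$ acting linearly on $C$ (written $x\mapsto T\cdot x$) such that (1) $G\cdot C=C$ and $G\cdot S_C=S_C$, and (2) every $s\in S_C$ can be written as a finite sum $s=\sum_{i}\lambda_i\,T_i\cdot r_i$ with $r_i\in R$, $T_i\in G$, $\lambda_i\in\mathbb{Z}_{\ge0}$. ''Not $(R,G)$-finitely generated'' means no such pair $(R,G)$ exists. *)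

(* Defs.v *)
From mathcomp Require Import all_boot all_order all_algebra.
From mathcomp Require Import all_classical all_reals.

Set Implicit Arguments.
Unset Strict Implicit.
Unset Printing Implicit Defensive.

Import Order.TTheory GRing.Theory Num.Theory.

Local Open Scope classical_set_scope.
Local Open Scope ring_scope.

Section Cones.
Variables (R : realType) (n : nat).
Implicit Types (C : set 'cV[R]_n) (u x y : 'cV[R]_n).

Definition intvec (z : 'cV[int]_n) : 'cV[R]_n := map_mx (fun a : int => a%:~R) z.

Definition ratvec (q : 'cV[rat]_n) : 'cV[R]_n := map_mx (@ratr R) q.

(* A convex cone contains the origin: take a = b = 0. *)
Definition convex_cone C : Prop :=
  C !=set0 /\
  forall (a b : R) x y, 0 <= a -> 0 <= b -> C x -> C y -> C (a *: x + b *: y).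

Definition polyhedral_cone C : Prop :=
  exists (k : nat) (A : 'M[R]_(k, n)),
    C = [set x | forall i : 'I_k, 0 <= (A *m x) i 0].

Definition affine_hull C : set 'cV[R]_n :=
  [set x | exists (k : nat) (a : 'I_k -> R) (v : 'I_k -> 'cV[R]_n),
    [/\ forall i, C (v i), \sum_(i < k) a i = 1 & x = \sum_(i < k) a i *: v i]].

Definition full_dimensional C : Prop := affine_hull C = setT.

Definition ray u : set 'cV[R]_n := [set c *: u | c in [set c : R | 0 < c]].

(* [ray u] together with the origin is a one-dimensional face of C; the
   summands are allowed to be 0 because [ray u] itself omits the origin. *)
Definition extreme_ray C u : Prop :=
  [/\ u <> 0, ray u `<=` C &
      forall x y, C x -> C y -> ray u (x + y) ->
        (x = 0 \/ ray u x) /\ (y = 0 \/ ray u y)].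

Definition rational_ray u : Prop :=
  exists q : 'cV[rat]_n, ray u = ray (ratvec q).

Definition lattice_points C : set 'cV[R]_n := C `&` range intvec.

Definition GLZ : set 'M[int]_n := [set T | \det T = 1 \/ \det T = -1].

Definition GLZ_subgroup (G : set 'M[int]_n) : Prop :=
  [/\ G `<=` GLZ, G 1%:M, forall S T, G S -> G T -> G (S *m T) &
      forall T, G T -> G (invmx T)].

Definition finitely_generated_subgroup (G : set 'M[int]_n) : Prop :=
  GLZ_subgroup G /\
  exists2 A : set 'M[int]_n, finite_set A & G = smallest GLZ_subgroup A.

Definition act (T : 'M[int]_n) x : 'cV[R]_n :=
  map_mx (fun a : int => a%:~R) T *m x.

Definition RG_generated_by C (F : set 'cV[R]_n) (G : set 'M[int]_n) : Prop :=
  [/\ [set act T x | T in G & x in C] = C,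
      [set act T x | T in G & x in lattice_points C] = lattice_points C &
      forall s, lattice_points C s ->
        exists (k : nat) (l : 'I_k -> nat) (T : 'I_k -> 'M[int]_n)
               (r : 'I_k -> 'cV[R]_n),
          [/\ forall i, G (T i), forall i, F (r i) &
              s = \sum_(i < k) act (T i) (r i) *+ l i]].

Definition RG_finitely_generated C : Prop :=
  exists (F : set 'cV[R]_n) (G : set 'M[int]_n),
    [/\ finite_set F, F `<=` lattice_points C,
        finitely_generated_subgroup G & RG_generated_by C F G].

End Cones.

(* Main.v *)
Require Import Defs.
From mathcomp Require Import all_boot all_order all_algebra.
From mathcomp Require Import all_classical all_reals.

(** The group [G] permutes the finitely many rational extreme rays. An integer
    matrix scaling a rational vector by a positive factor scales it by at least
    [1] (look at the shortest integer vector on the ray), so an element of [G]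
    is determined by its permutation of a spanning set of rays, and [G] is
    finite. Hence the lattice points of [C] lie in the cone [P] generated by the
    finite set [G F], which is polyhedral by Fourier-Motzkin elimination. Finally
    [C] is contained in [P]: adding to [x] in [C] a small nonnegative combination
    of the rational spanning vectors of [C] yields rational points of [C]
    arbitrarily close to [x], and [P] is defined by finitely many weak linear
    inequalities. *)

Set Implicit Arguments.
Unset Strict Implicit.
Unset Printing Implicit Defensive.

Import Order.TTheory GRing.Theory Num.Theory.

Local Open Scope classical_set_scope.
Local Open Scope ring_scope.

(** A counting principle in relational form: the action on rays is given by a relation, and [g], a
    partial inverse of [r] on a finite type, already reaches all of [G]. *)
Lemma finite_set_inj_rel (T : choiceType) (U : finType) (G : set T)
    (r : T -> U -> Prop) :
  (forall x, G x -> exists y, r x y) ->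
  (forall x x' y, G x -> G x' -> r x y -> r x' y -> x = x') ->
  finite_set G.
Proof.
move=> rtot rinj; have [->|/set0P[x0 _]] := eqVneq G set0; first exact: finite_set0.
pose g y := xget x0 [set x | G x /\ r x y].
have sub : G `<=` range g.
  move=> x Gx; have [y rxy] := rtot x Gx; exists y => //.
  by apply: xget_unique => // x' [Gx' rx'y]; apply: (rinj _ _ y).
apply: sub_finite_set sub _; apply: finite_image; exact: finite_finset.
Qed.

(** * Finitely generated cones and Fourier-Motzkin elimination *)

Section FinitelyGeneratedCones.
Variables (R : realFieldType) (n : nat).
Implicit Types (s : seq 'cV[R]_n) (h : seq 'rV[R]_n) (x y v : 'cV[R]_n).

(** Recursion removes one generator at a time, so that each step is the elimination of a single
    variable [t]. *)
Fixpoint conic_hull s x : Prop :=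
  if s is v :: s' then exists2 t : R, 0 <= t & conic_hull s' (x - t *: v)
  else x = 0.

Lemma conic_hull0 s : conic_hull s 0.
Proof. by elim: s => //= v s IH; exists 0; rewrite // scale0r subr0. Qed.

Lemma conic_hullD s x y :
  conic_hull s x -> conic_hull s y -> conic_hull s (x + y).
Proof.
elim: s x y => [|v s IH] x y /=; first by move=> -> ->; rewrite addr0.
move=> [a a0 xa] [b b0 yb]; exists (a + b); first exact: addr_ge0.
by rewrite scalerDl opprD addrACA; apply: IH.
Qed.

Lemma conic_hullZ s c x : 0 <= c -> conic_hull s x -> conic_hull s (c *: x).
Proof.
move=> c0; elim: s x => [|v s IH] x /=; first by move=> ->; rewrite scaler0.
move=> [a a0 xa]; exists (c * a); first exact: mulr_ge0.
by rewrite -scalerA -scalerBr; apply: IH.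
Qed.

Lemma mem_conic_hull s v : v \in s -> conic_hull s v.
Proof.
elim: s => //= w s IH; rewrite inE => /orP[/eqP ->|/IH vs].
  by exists 1; rewrite // scale1r subrr; apply: conic_hull0.
by exists 0; rewrite // scale0r subr0.
Qed.

Definition halfspaces h x : bool := all (fun a => 0 <= (a *m x) 0 0) h.

(* One step of Fourier-Motzkin elimination: the existence of [t >= 0] with
   [t * (a v) <= a x] for all [a] in [h] is expressed by comparing each upper
   bound for [t] with each lower bound, [0] included. *)
Lemma halfspaces_add_ray h v :
  exists h', forall x,
    (exists2 t : R, 0 <= t & halfspaces h (x - t *: v)) <-> halfspaces h' x.
Proof.
pose f (a : 'rV[R]_n) := (a *m v) 0 0.
have fE a x t : (a *m (x - t *: v)) 0 0 = (a *m x) 0 0 - t * f a.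
  by rewrite /f mulmxBr -scalemxAr !mxE.
(* The first list compares upper bounds with 0 and keeps the constraints free of [t]; the second
   compares upper with lower bounds, denominators cleared. *)
exists ([seq a <- h | 0 <= f a] ++
  [seq f a *: b - f b *: a | a <- [seq a <- h | 0 < f a],
                             b <- [seq b <- h | f b < 0]]) => x.
have pairE (a b : 'rV[R]_n) : ((f a *: b - f b *: a) *m x) 0 0 =
    f a * (b *m x) 0 0 - f b * (a *m x) 0 0.
  by rewrite mulmxBl -!scalemxAl !mxE.
rewrite /halfspaces all_cat; split.
  move=> [t t0 /allP ht]; apply/andP; split.
    apply/allP => a; rewrite mem_filter => /andP[fa /ht]; rewrite fE subr_ge0.
    by apply: le_trans; apply: mulr_ge0.
  apply/allP => w /allpairsP[[a b] /= [] + + ->].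
  rewrite !mem_filter => /andP[fa /ht]; rewrite fE subr_ge0 => ha.
  move=> /andP[fb /ht]; rewrite fE subr_ge0 => hb.
  rewrite pairE subr_ge0 (@le_trans _ _ (f a * (t * f b))) //.
    rewrite mulrA (mulrC (f a)) (mulrC _ (f b)).
    by rewrite ler_wnM2l // ltW.
  by rewrite ler_wpM2l // ltW.
move=> /andP[/allP h1 /allP h2].
(* The largest lower bound; the default 0 accounts for [0 <= t]. *)
pose t := \big[Order.max/0]_(b <- h | f b < 0) ((b *m x) 0 0 / f b).
exists t; first by rewrite /t; elim/big_rec: _ => // b y _ y0; rewrite le_max y0 orbT.
apply/allP => a ah; rewrite fE subr_ge0.
case: (ltgtP (f a) 0) => fa.
- rewrite -ler_ndivrMr //.
  exact: (le_bigmax_seq 0 a (fun b => f b < 0)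
           (fun b => (b *m x) 0 0 / f b) ah fa).
- rewrite -ler_pdivlMr // /t big_seq_cond; apply: bigmax_le.
    by apply: divr_ge0 (ltW fa); apply: h1; rewrite mem_filter ltW.
  move=> b /andP[bh fb].
  have := h2 (f a *: b - f b *: a); rewrite pairE subr_ge0 => H.
  rewrite ler_ndivrMr // mulrAC ler_pdivrMr // mulrC [leRHS]mulrC.
  by apply: H; apply/allpairsP; exists (a, b); rewrite !mem_filter fa fb ah bh.
- by rewrite fa mulr0; apply: h1; rewrite mem_filter fa lexx.
Qed.

(** Weyl's half of the Minkowski-Weyl theorem, by induction on the generators; the empty hull is cut
    out by the inequalities [x i 0 >= 0] and [- x i 0 >= 0]. *)
Lemma conic_hull_halfspaces s :
  exists h, forall x, conic_hull s x <-> halfspaces h x.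
Proof.
elim: s => [|v s [h hE]] /=.
  exists ([seq delta_mx 0 i | i : 'I_n] ++ [seq - delta_mx 0 i | i : 'I_n]) => x.
  have dE i : ((delta_mx 0 i : 'rV[R]_n) *m x) 0 0 = x i 0 by rewrite -rowE mxE.
  split=> [-> | /allP hx].
    by apply/allP => a _; rewrite mulmx0 mxE.
  apply/colP => i; rewrite mxE; apply: le_anti; apply/andP; split.
    rewrite -oppr_ge0.
    have := hx (- delta_mx 0 i); rewrite mulNmx mxE dE; apply.
    by rewrite mem_cat; apply/orP; right; apply/fintype.imageP; exists i.
  have := hx (delta_mx 0 i); rewrite dE; apply.
  by rewrite mem_cat; apply/orP; left; apply/fintype.imageP; exists i.
have [h' h'E] := halfspaces_add_ray h v.
exists h' => x; rewrite -h'E; split=> -[t t0 /hE]; by exists t.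
Qed.

End FinitelyGeneratedCones.

(** * Integer matrices, rational rays and finiteness of the group *)

Section Lattice.
Variables (R : realType) (n : nat).
Implicit Types (x : 'cV[R]_n) (q : 'cV[rat]_n) (z : 'cV[int]_n).
Implicit Types (S T : 'M[int]_n).

Lemma ratvec_clear_denominators q :
  exists (D : nat) z, (0 < D)%N /\ intvec R z = D%:R *: ratvec R q.
Proof.
pose d i := absz (denq (q i 0)).
exists (\prod_i d i)%N, (\col_i (numq (q i 0) * (\prod_(j | j != i) d j)%N%:Z)).
split; first by rewrite prodn_gt0 // => i; rewrite absz_gt0 denq_neq0.
apply/colP => i; rewrite !mxE [in RHS](bigD1 i) //= intrM natrM -pmulrn mulrAC.
congr (_ * _); rewrite /d pmulrn gez0_abs // /ratr mulrC divfK //.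
by rewrite intr_eq0 denq_neq0.
Qed.

Lemma act1 x : act 1%:M x = x.
Proof. by rewrite /act map_mx1 mul1mx. Qed.

Lemma actM S T x : act (S *m T) x = act S (act T x).
Proof. by rewrite /act map_mxM mulmxA. Qed.

Lemma act_intvec T z : act T (intvec R z) = intvec R (T *m z).
Proof. by rewrite /act /intvec map_mxM. Qed.

Lemma act_ratvec T q :
  act T (ratvec R q) = ratvec R (map_mx (fun a : int => a%:~R) T *m q).
Proof.
rewrite /act /ratvec map_mxM; congr (_ *m _).
by apply/matrixP => i j; rewrite !mxE /= ratr_int.
Qed.

Lemma GLZ_unitmx T : GLZ T -> T \in unitmx.
Proof. by rewrite unitmxE => -[] ->; rewrite ?unitrN unitr1. Qed.

(* Among the integer vectors on the ray of [q], one whose [j]-th entry is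
   shortest is not shortened by [T]. *)
Lemma rational_eigenvalue_ge1 T q (e : R) :
  q != 0 -> 0 < e -> act T (ratvec R q) = e *: ratvec R q -> 1 <= e.
Proof.
move=> /cV0Pn[j qj] e0 Tq.
pose P k := `[< exists z, absz (z j 0) = k /\
  exists2 c : R, 0 < c & intvec R z = c *: ratvec R q >].
have exP : exists k, P k.
  have [D [z [D0 zq]]] := ratvec_clear_denominators q.
  exists (absz (z j 0)); apply/asboolP; exists z; split=> //.
  by exists D%:R => //; rewrite ltr0n.
case: (ex_minnP exP) => _ /asboolP[z [<- [c c0 zq]]] zmin.
have Tz : intvec R (T *m z) = e *: intvec R z.
  by rewrite -act_intvec zq /act -scalemxAr -/(act _ _) Tq !scalerA mulrC.
have : (absz (z j 0%R) <= absz ((T *m z)%R j 0%R))%N.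
  apply: zmin; apply/asboolP; exists (T *m z); split=> //.
  by exists (e * c); [apply: mulr_gt0|rewrite Tz zq scalerA].
have zj : ((z j 0)%:~R : R) != 0.
  move/colP/(_ j): zq; rewrite !mxE => ->.
  by apply: mulf_neq0; rewrite ?fmorph_eq0 // gt_eqF.
have Tzj : ((T *m z) j 0)%:~R = e * (z j 0)%:~R.
  by move/colP/(_ j): Tz; rewrite /intvec [LHS]mxE => ->; rewrite !mxE.
rewrite -(ler_nat R) !natr_absz !intr_norm Tzj.
by rewrite normrM (gtr0_norm e0) ler_pMl // normr_gt0.
Qed.

Lemma ray_id x : ray x x.
Proof. by exists 1; rewrite ?scale1r //= ltr01. Qed.

Variables (C : set 'cV[R]_n) (G : set 'M[int]_n).
Hypotheses (hG : GLZ_subgroup G) (GC : forall T x, G T -> C x -> C (act T x)).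

(** Both [T] and its inverse preserve [C], so a decomposition on the image ray is pulled back, split
    by the face property of [x], and pushed forward. *)
Lemma extreme_ray_act T x : G T -> extreme_ray C x -> extreme_ray C (act T x).
Proof.
case: hG => GL _ _ GV GT [x0 xC xface].
have uT := GLZ_unitmx (GL _ GT); have GT' := GV _ GT.
have TK (y : 'cV[R]_n) : act (invmx T) (act T y) = y by rewrite -actM mulVmx // act1.
have KT (y : 'cV[R]_n) : act T (act (invmx T) y) = y by rewrite -actM mulmxV // act1.
have rayT y : act (invmx T) y = 0 \/ ray x (act (invmx T) y) ->
    y = 0 \/ ray (act T x) y.
  rewrite -{3 4}(KT y) => -[->|[c c0 <-]]; first by left; rewrite /act mulmx0.
  by right; exists c; rewrite // /act -scalemxAr.
split.
- by move=> Tx0; apply: x0; rewrite -(TK x) Tx0 /act mulmx0.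
- move=> _ [c c0 <-]; rewrite /act scalemxAr; apply: GC => //.
  by apply: xC; exists c.
- move=> y z Cy Cz [c c0 yz].
  have [|Hy Hz] := xface _ _ (GC GT' Cy) (GC GT' Cz); last by split; apply: rayT.
  exists c => //; rewrite /act -mulmxDr -yz -scalemxAr; congr (_ *: _).
  by rewrite -/(act _ _) -/(act _ _) TK.
Qed.

Variables (m : nat) (u : 'I_m -> 'cV[rat]_n).
Hypothesis hspan : <<[seq ratvec R (u i) | i : 'I_m]>>%VS = fullv.

Lemma ratvec_span_sum x : exists a : 'I_m -> R, x = \sum_i a i *: ratvec R (u i).
Proof.
pose X : m.-tuple 'cV[R]_n := [tuple ratvec R (u i) | i < m].
have Xx : x \in <<X>>%VS by rewrite /= hspan memvf.
exists (fun i => coord X i x); rewrite {1}(coord_span Xx).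
by apply: eq_bigr => i _; rewrite -tnth_nth tnth_mktuple.
Qed.

Lemma act_inj_on_span S T :
  (forall i, act S (ratvec R (u i)) = act T (ratvec R (u i))) -> S = T.
Proof.
move=> ST; have STx x : act S x = act T x.
  have [a ->] := ratvec_span_sum x.
  rewrite /act !mulmx_sumr; apply: eq_bigr => i _.
  by rewrite -!scalemxAr; congr (_ *: _); apply: ST.
apply/matrixP => i j.
have /colP/(_ i) := STx (delta_mx j 0); rewrite /act -!colE !mxE.
exact: intr_inj.
Qed.

Hypothesis hext : forall i : 'I_m, extreme_ray C (ratvec R (u i)).
Hypothesis hall : forall v : 'cV[R]_n, extreme_ray C v -> rational_ray v ->
  exists i : 'I_m, ray v = ray (ratvec R (u i)).

Lemma finite_extreme_ray_group : finite_set G.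
Proof.
pose r T (f : {ffun 'I_m -> 'I_m}) :=
  forall i, ray (ratvec R (u (f i))) (act T (ratvec R (u i))).
case: (hG) => GL _ _ _.
(* If [S] and [T] send [u i] to the same ray, then [invmx T *m S] scales it by [c / d], which is at
   least 1. By symmetry [c = d], so the target rays determine the matrix. *)
have le S T i j c d : G S -> G T -> 0 < c -> 0 < d ->
    c *: ratvec R (u j) = act S (ratvec R (u i)) ->
    d *: ratvec R (u j) = act T (ratvec R (u i)) -> d <= c.
  move=> GS GT c0 d0 Su Tu.
  rewrite -[leRHS](mulfVK (lt0r_neq0 d0)) ler_peMl ?(ltW d0) //.
  have ui : u i != 0.
    by apply/eqP => ui; case: (hext i) => + _ _; apply; rewrite ui /ratvec map_mx0.
  apply: (rational_eigenvalue_ge1 (T := invmx T *m S) ui); first exact: divr_gt0.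
  have -> : act (invmx T *m S) (ratvec R (u i)) = act (invmx T) (c *: ratvec R (u j)).
    by rewrite actM Su.
  rewrite -[c in LHS](mulfVK (lt0r_neq0 d0)) -scalerA Tu /act -scalemxAr.
  by rewrite -!/(act _ _) -actM mulVmx ?act1 //; apply/GLZ_unitmx/GL.
apply: (@finite_set_inj_rel _ _ _ r).
  move=> T GT; have ex i : exists j, ray (ratvec R (u j)) (act T (ratvec R (u i))).
    have [|j jE] := hall (extreme_ray_act GT (hext i)).
      by exists (map_mx (fun a : int => a%:~R) T *m u i); rewrite act_ratvec.
    by exists j; rewrite -jE; apply: ray_id.
  have [f fP] := choice ex.
  by exists [ffun i => f i] => i; rewrite ffunE.
move=> S T f GS GT Sf Tf; apply: act_inj_on_span => i.
have [c c0 Sc] := Sf i; have [d d0 Td] := Tf i.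
rewrite -Sc -Td; congr (_ *: _); apply/le_anti.
by rewrite (le _ _ _ _ _ _ GS GT c0 d0 Sc Td) (le _ _ _ _ _ _ GT GS d0 c0 Td Sc).
Qed.

(** * Inequalities valid on lattice points extend to the cone *)

Hypothesis hC : convex_cone C.

Lemma convex_coneD x y : C x -> C y -> C (x + y).
Proof.
by move=> Cx Cy; have := hC.2 1 1 _ _ ler01 ler01 Cx Cy; rewrite !scale1r.
Qed.

Lemma convex_coneZ c x : 0 <= c -> C x -> C (c *: x).
Proof. by move=> c0 Cx; have := hC.2 c 0 _ _ c0 (lexx 0) Cx Cx; rewrite scale0r addr0. Qed.

Lemma convex_cone0 : C 0.
Proof. by have [y Cy] := hC.1; rewrite -(scale0r y); apply: convex_coneZ. Qed.

Lemma conic_hull_sub s : (forall v, v \in s -> C v) -> conic_hull s `<=` C.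
Proof.
elim: s => [|v s IH] sC x /=; first by move=> ->; apply: convex_cone0.
move=> [t t0 /IH xs]; rewrite -[x](subrK (t *: v)); apply: convex_coneD.
  by apply: xs => w ws; apply: sC; rewrite inE ws orbT.
by apply: convex_coneZ => //; apply: sC; rewrite inE eqxx.
Qed.

(** An inequality failing at [x] fails at a nearby rational point of [C], hence at a lattice point
    once denominators are cleared. *)
Lemma cone_sub_halfspaces (h : seq 'rV[R]_n) :
  (forall x, lattice_points C x -> halfspaces h x) ->
  forall x, C x -> halfspaces h x.
Proof.
move=> hlat x Cx; apply/allP => a ah; rewrite leNgt; apply/negP => ax.
have uC i : C (ratvec R (u i)) by case: (hext i) => _ + _; apply; apply: ray_id.
have [c xE] := ratvec_span_sum x.
pose g i := (a *m ratvec R (u i)) 0 0.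
(* Moving each coefficient by less than [eps] changes the value of [a] by at most
   [eps * \sum_i |g i|], which is less than [- (a *m x) 0 0]; the summand 1 makes this strict and
   [M] positive. *)
pose M := 1 + \sum_i `|g i|.
have M0 : 0 < M by rewrite ltr_pwDl // sumr_ge0.
pose eps := - (a *m x) 0 0 / M.
have eps0 : 0 < eps by rewrite divr_gt0 // oppr_gt0.
(* Approximating from above makes the correction to [x] a nonnegative combination of the [u i], so
   the new point stays in [C]. *)
have ex i : exists q : rat, ratr q \in `](c i), (c i + eps)[.
  by apply: rat_in_itvoo; rewrite ltrDl.
have [b bP] := choice ex.
pose q := \sum_i b i *: u i.
have qE : ratvec R q = \sum_i ratr (b i) *: ratvec R (u i).
  by rewrite /ratvec map_mx_sum; apply: eq_bigr => i _; rewrite map_mxZ.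
have qx : ratvec R q = x + \sum_i (ratr (b i) - c i) *: ratvec R (u i).
  rewrite qE xE -big_split /=; apply: eq_bigr => i _.
  by rewrite -scalerDl addrC subrK.
have Cq : C (ratvec R q).
  rewrite qx; apply: convex_coneD => //.
  elim/big_ind: _ => //; [exact: convex_cone0|exact: convex_coneD|].
  move=> i _; apply: convex_coneZ => //.
  by have := bP i; rewrite in_itv /= subr_ge0 => /andP[/ltW].
have aq : (a *m ratvec R q) 0 0 < 0.
  rewrite qx mulmxDr mulmx_sumr mxE summxE -ltrBrDl sub0r.
  apply: (@le_lt_trans _ _ (\sum_i eps * `|g i|)).
    apply: ler_sum => i _; rewrite -scalemxAr mxE -/(g i).
    have := bP i; rewrite in_itv /= => /andP[b1 b2].
    apply: le_trans (ler_norm _) _; rewrite normrM ler_wpM2r //.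
    by rewrite gtr0_norm ?subr_gt0 // lerBlDl ltW.
  rewrite -mulr_sumr /eps mulrAC ltr_pdivrMr // ltr_pM2l ?oppr_gt0 //.
  by rewrite /M ltrDr ltr01.
have [D [z [D0 zq]]] := ratvec_clear_denominators q.
have /hlat/allP/(_ _ ah) : lattice_points C (intvec R z).
  by split; [rewrite zq; apply: convex_coneZ|exists z].
by rewrite zq -scalemxAr mxE pmulr_rge0 ?ltr0n // leNgt aq.
Qed.

End Lattice.

Theorem theorem1p2 (R : realType) (n : nat) (C : set 'cV[R]_n)
    (hC : convex_cone C) (hfull : full_dimensional C)
    (hnpoly : ~ polyhedral_cone C)
    (m : nat) (u : 'I_m -> 'cV[rat]_n)
    (hext : forall i : 'I_m, extreme_ray C (ratvec R (u i)))
    (hall : forall v : 'cV[R]_n, extreme_ray C v -> rational_ray v ->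
      exists i : 'I_m, ray v = ray (ratvec R (u i)))
    (hspan : <<[seq ratvec R (u i) | i : 'I_m]>>%VS = fullv) :
  ~ RG_finitely_generated C.
Proof.
move=> [F [G [finF FC [hG _] [GC _ gen]]]].
have GCx T x : G T -> C x -> C (act T x).
  by move=> GT Cx; rewrite -GC; exists T => //; exists x.
have finG := finite_extreme_ray_group hG GCx hspan hext hall.
(* Finiteness of [G] turns the generation of lattice points up to [G] into ordinary generation by
   the finite list [s] of translates. *)
have /finite_seqP[s sE] := finite_image2 (@act R n) finG finF.
have sP x : (x \in s) = (x \in [set act T r | T in G & r in F]).
  by rewrite sE; apply/idP/idP; rewrite inE.
have [h hE] := conic_hull_halfspaces s.
pose A := \matrix_(i < size h) h`_i.
have AE x (i : 'I_(size h)) : (A *m x) i 0 = (h`_i *m x) 0 0.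
  by rewrite !mxE; apply: eq_bigr => j _; rewrite mxE.
apply: hnpoly; exists (size h), A.
apply/seteqP; split=> x /=.
  move=> Cx i; have : halfspaces h x.
    apply: (cone_sub_halfspaces hspan hext hC) Cx => y /gen.
    move=> [k [l [T [r [GT Fr ->]]]]]; apply/hE.
    elim/big_ind: _ => //; [exact: conic_hull0|exact: conic_hullD|].
    move=> j _; rewrite -scaler_nat; apply: conic_hullZ => //.
    apply: mem_conic_hull; rewrite sP inE; exists (T j) => //.
    by exists (r j).
  by move=> /allP/(_ _ (mem_nth 0 (ltn_ord i))); rewrite AE.
(* Conversely, the translates listed in [s] lie in [C], and so does their conic hull. *)
move=> hx; have : conic_hull s x.
  apply/hE/allP => a /(nthP 0)[i ih <-].
  by have := hx (Ordinal ih); rewrite AE.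
apply: conic_hull_sub => // v; rewrite sP inE => -[T GT [r Fr <-]].
by apply: GCx => //; case: (FC _ Fr).
Qed.
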